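(* Let $H$ be a real Hilbert space, let $f:H\to H$ be Lipschitz continuous, let $D:H\to H$ be a monotone bounded linear operator, let $\Omega\subset H$ be a nonempty closed convex set, and put $K(x):=\Omega-Df(x)$ for $x\in H$. If $f$ is strongly monotone, then $x^*\in H$ is a solution of the quasi-variational inequality $$0\in f(x^* )+N_{K(x^* )}(x^* )$$ if and only if $y^*=(f^{-1}+D)f(x^* )=x^*+Df(x^* )$ is the unique solution of the strongly monotone variational inequality $$0\in (f^{-1}+D)^{-1}(y^* )+N_\Omega(y^* ).$$
   Context: $f:H\to H$ is strongly monotone if there is $\mu>0$ with $\langle f(x)-f(y),x-y\rangle\ge\mu\|x-y\|^2$ for all $x,y\in H$. For a closed convex set $K\subset H$ and $x\in K$, the normal cone is $N_K(x)=\{x^*\in H:\langle x^*,y-x\rangle\le 0\text{ for all }y\in K\}$, and $N_K(x)=\emptyset$ for $x\notin K$. ''Strongly monotone variational inequality'' means that the operator $(f^{-1}+D)^{-1}$ in it is strongly monotone. *)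

(* Defs.v *)
From HB Require Import structures.
From mathcomp Require Import all_boot all_order all_algebra.
From mathcomp Require Import all_classical all_reals all_analysis.
Import Order.TTheory GRing.Theory Num.Theory numFieldNormedType.Exports.
Set Implicit Arguments.
Unset Strict Implicit.
Unset Printing Implicit Defensive.
Local Open Scope classical_set_scope.
Local Open Scope ring_scope.

(* A real Hilbert space: a complete normed space whose norm is induced by an
   inner product, i.e. by a symmetric positive definite bilinear form. *)
HB.mixin Record CompleteNormedModule_isHilbert (R : realType) H
    of CompleteNormedModule R H := {
  inner : {dot H for idfun} ;
  inner_norm : forall x : H, inner x x = `|x| ^+ 2
}.

#[short(type="hilbertType")]
HB.structure Definition Hilbert (R : realType) :=
  {H of CompleteNormedModule_isHilbert R H & CompleteNormedModule R H}.

Section operators.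
Context {R : realType} {H : hilbertType R}.

Local Notation "'<< x , y >>" := (inner x y)
  (at level 0, x at level 99, y at level 99).

Definition monotone_op (f : H -> H) :=
  forall x y : H, 0 <= '<< f x - f y, x - y >>.

Definition strongly_monotone_op (f : H -> H) :=
  exists2 mu : R, 0 < mu &
    forall x y : H, mu * `|x - y| ^+ 2 <= '<< f x - f y, x - y >>.

(* Set-valued operators on H are functions H -> set H; op_inv A is the
   converse relation, so op_inv (op_fun f) needs no invertibility of f. *)
Definition op_fun (f : H -> H) : H -> set H := fun x => [set f x].

Definition op_inv (A : H -> set H) : H -> set H := fun y => [set x | A x y].

Definition minkowski_sum (A B : set H) : set H :=
  [set z | exists2 a, A a & exists2 b, B b & z = a + b].

Definition op_add (A B : H -> set H) : H -> set H :=
  fun x => minkowski_sum (A x) (B x).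

(* Membership of x in K makes the cone empty off K. *)
Definition normal_cone (K : set H) (x : H) : set H :=
  [set u | K x /\ forall y, K y -> '<< u, y - x >> <= 0].

(* 0 \in A x + N_{K x} x; a variational inequality is the case of constant K. *)
Definition solves_qvi (A : H -> set H) (K : H -> set H) (x : H) : Prop :=
  op_add A (fun z => normal_cone (K z) z) x 0.

Definition solves_vi (A : H -> set H) (Omega : set H) (x : H) : Prop :=
  solves_qvi A (fun=> Omega) x.

End operators.

(* Main.v *)
(* If f is Lipschitz and strongly monotone, then so is its inverse, and hence
   f^-1 + D is Lipschitz and strongly monotone as well; applying the same fact
   to f^-1 + D shows that (f^-1 + D)^-1 is a strongly monotone map, so the
   variational inequality has at most one solution.  Moreover
   (f^-1 + D)^-1 (x + D (f x)) = f x, and the two inequalities correspond under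
   the translation by D (f x), which maps K x onto Omega. *)
Require Import Defs.
From HB Require Import structures.
From mathcomp Require Import all_boot all_order all_algebra.
From mathcomp Require Import all_classical all_reals all_analysis.
From mathcomp Require Import ring lra.
Set Implicit Arguments.
Unset Strict Implicit.
Import Order.TTheory GRing.Theory Num.Theory numFieldNormedType.Exports.
Local Open Scope classical_set_scope.
Local Open Scope ring_scope.

Lemma innerC (R : realType) (H : hilbertType R) (x y : H) :
  inner x y = inner y x.
Proof. by rewrite hermC /= expr0 mul1r. Qed.

Lemma sqr_normBZ (R : realType) (H : hilbertType R) (s : R) (x y : H) :
  `|x - s *: y| ^+ 2 = `|x| ^+ 2 - 2 * s * inner x y + s ^+ 2 * `|y| ^+ 2.
Proof.
have sxE u v : inner (u - s *: y) v = inner u v - s * inner y v.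
  by rewrite linearBl /= linearZl_LR.
rewrite -!inner_norm sxE (innerC x) (innerC y) !sxE (innerC y x); ring.
Qed.

Lemma klipschitzTP (R : numFieldType) (V W : normedModType R) (k : R)
    (f : V -> W) :
  k.-lipschitz f <-> forall x y, `|f x - f y| <= k * `|x - y|.
Proof.
split=> [fk x y|fk [x y] _]; last exact: fk.
exact: (fk (x, y)).
Qed.

Lemma klipschitzT_lipschitz (R : numFieldType) (V W : normedModType R) (k : R)
    (f : V -> W) :
  (forall x y, `|f x - f y| <= k * `|x - y|) -> lipschitz f.
Proof.
move=> /klipschitzTP; apply: klipschitzW.
by apply: (@globally_properfilter _ _ (0, 0)).
Qed.

(** [lipschitz] asserts the bound for all large enough constants, so one of them can be taken
    positive and later divided by. *)
Lemma lipschitzT_gt0 (R : realType) (V W : normedModType R) (f : V -> W) :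
  lipschitz f -> exists2 k : R, 0 < k & k.-lipschitz f.
Proof.
move=> fL; near (+oo : set_system R) => k.
exists k; near: k; first exact: nbhs_pinfty_gt.
exact: fL.
Unshelve. all: by end_near. Qed.

Lemma strongly_monotone_expansive (R : realType) (H : hilbertType R) (mu : R)
    (f : H -> H) : 0 < mu ->
  (forall x y, mu * `|x - y| ^+ 2 <= inner (f x - f y) (x - y)) ->
  forall x y, mu * `|x - y| <= `|f x - f y|.
Proof.
move=> mu0 fmu x y.
rewrite -ler_sqr ?nnegrE ?mulr_ge0 ?(ltW mu0)// exprMn.
(* Expanding this square replaces Cauchy-Schwarz: |f x - f y|^2 is at least 2 mu <f x - f y, x - y>
   - mu^2 |x - y|^2, hence at least mu^2 |x - y|^2. *)
have := sqr_ge0 `|f x - f y - mu *: (x - y)|.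
rewrite sqr_normBZ => dist_ge0.
have := ler_wpM2l (ltW mu0) (fmu x y).
by nra.
Qed.

(* The damped iteration x |-> x - s (f x - y) is a contraction for
   s = mu / (L^2 + mu^2), with constant sqrt (L^2 / (L^2 + mu^2)). *)
Lemma strongly_monotone_surjective (R : realType) (H : hilbertType R)
    (f : H -> H) : lipschitz f -> strongly_monotone_op f ->
  forall y, exists x, f x = y.
Proof.
move=> /lipschitzT_gt0[L L0 /klipschitzTP fL] [mu mu0 fmu] y.
set k := L ^+ 2 + mu ^+ 2.
have k0 : 0 < k by rewrite addr_gt0 ?exprn_gt0.
have [s s0 sk] : exists2 s, 0 < s & s * k = mu.
  by exists (mu / k); rewrite ?divr_gt0// divfK ?gt_eqF.
pose c := 1 - s * mu.
have c0 : 0 <= c.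
  (* Since s k = mu, multiplying c by k gives k - mu^2 = L^2. *)
  rewrite -(pmulr_lge0 _ k0) mulrBl mul1r mulrAC sk -expr2 /k addrK.
  exact: sqr_ge0.
have c1 : c < 1 by rewrite /c ltrBlDr ltrDl mulr_gt0.
pose phi (x : H) : H := x - s *: (f x - y).
have phiL u v : `|phi u - phi v| <= Num.sqrt c * `|u - v|.
  rewrite -ler_sqr ?nnegrE ?mulr_ge0 ?sqrtr_ge0// exprMn sqr_sqrtr//.
  have -> : phi u - phi v = (u - v) - s *: (f u - f v).
    by rewrite /phi opprD addrACA -opprD -scalerBr opprB addrA subrK.
  rewrite sqr_normBZ innerC.
  have mono := ler_wpM2l (ltW s0) (fmu u v).
  have lip : `|f u - f v| ^+ 2 <= L ^+ 2 * `|u - v| ^+ 2.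
    by rewrite -exprMn ler_sqr ?nnegrE ?mulr_ge0 ?(ltW L0).
  have {lip} := ler_wpM2l (sqr_ge0 s) lip.
  (* As s L^2 <= s k = mu, the quadratic term costs at most half of the gain 2 s mu from
     monotonicity, which leaves c. *)
  have : s ^+ 2 * L ^+ 2 * `|u - v| ^+ 2 <= s * mu * `|u - v| ^+ 2.
    rewrite ler_wpM2r ?sqr_ge0// -sk expr2 -!mulrA !ler_wpM2l ?(ltW s0)//.
    by rewrite /k lerDl sqr_ge0.
  by rewrite /c; lra.
have phiT : {homo phi : x / [set: H] x} by [].
have [|||x _ xE] := @banach_fixed_point R H setT [fun of mkfun phiT].
- exists (NngNum (sqrtr_ge0 c)); split => /=; last exact/klipschitzTP.
  by rewrite -sqrtr1 ltr_sqrt.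
- exact: closedT.
- by exists 0.
exists x; apply/eqP; rewrite -subr_eq0.
have : s *: (f x - y) == 0.
  rewrite -oppr_eq0 -(inj_eq (addrI x)) addr0; exact/eqP/esym.
by rewrite scaler_eq0 gt_eqF.
Qed.

(** Expansiveness makes [f] injective and its inverse Lipschitz with constant 1/mu. *)
Lemma strongly_monotone_inverse (R : realType) (H : hilbertType R)
    (f : H -> H) : lipschitz f -> strongly_monotone_op f ->
  exists g : H -> H, [/\ cancel f g, cancel g f,
    lipschitz g & strongly_monotone_op g].
Proof.
move=> fL fM.
have [g gK] := choice (strongly_monotone_surjective fL fM).
have [mu mu0 fmu] := fM.
have fE := strongly_monotone_expansive mu0 fmu.
have fK : cancel f g.
  move=> x; apply/eqP; rewrite -subr_eq0 -normr_le0 -(ler_pM2l mu0) mulr0.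
  by rewrite (le_trans (fE _ _))// gK subrr normr0.
exists g; split => //.
  apply: (@klipschitzT_lipschitz _ _ _ mu^-1) => x y.
  by rewrite ler_pdivlMl// -{2}[x]gK -{2}[y]gK.
have [L L0 /klipschitzTP lip] := lipschitzT_gt0 fL.
(* With x = f (g x) and y = f (g y), the inner product is at least mu |g x - g y|^2, and |x - y| <=
   L |g x - g y|. *)
exists (mu / L ^+ 2); first by rewrite divr_gt0// exprn_gt0.
move=> x y; rewrite innerC -{2}[x]gK -{2}[y]gK.
apply: le_trans (fmu _ _); rewrite -mulrA ler_pM2l// ler_pdivrMl ?exprn_gt0//.
by rewrite -exprMn ler_sqr ?nnegrE ?mulr_ge0 ?(ltW L0)// -{1}[x]gK -{1}[y]gK.
Qed.

Lemma lipschitz_add (R : realType) (V W : normedModType R) (f g : V -> W) :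
  lipschitz f -> lipschitz g -> lipschitz (fun x => f x + g x).
Proof.
move=> /lipschitzT_gt0[k _ /klipschitzTP fk] /lipschitzT_gt0[l _ /klipschitzTP gl].
apply: (@klipschitzT_lipschitz _ _ _ (k + l)) => x y.
by rewrite opprD addrACA mulrDl (le_trans (ler_normD _ _))// lerD.
Qed.

Lemma strongly_monotone_addr (R : realType) (H : hilbertType R) (f g : H -> H) :
  strongly_monotone_op f -> monotone_op g ->
  strongly_monotone_op (fun x => f x + g x).
Proof.
move=> [mu mu0 fmu] gM; exists mu => // x y.
by rewrite opprD addrACA linearDl ler_wpDr//; exact: gM.
Qed.

(** For a single-valued operator the normal vector in the inclusion must be - f x, which yields the
    Stampacchia form. *)
Lemma solves_qvi_fun (R : realType) (H : hilbertType R) (f : H -> H)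
    (K : H -> set H) (x : H) :
  solves_qvi (op_fun f) K x <->
  K x x /\ forall y, K x y -> 0 <= inner (f x) (y - x).
Proof.
split=> [[_ -> [n [Kx nK] /eqP]]|[Kx fK]].
  rewrite eq_sym addrC addr_eq0 => /eqP nE; split=> // y /nK.
  by rewrite nE linearNl oppr_le0.
exists (f x) => //; exists (- f x); last by rewrite subrr.
by split=> // y /fK; rewrite linearNl oppr_le0.
Qed.

(** Testing each inequality at the other solution and adding gives <t x - t y, x - y> <= 0. *)
Lemma strongly_monotone_vi_unique (R : realType) (H : hilbertType R)
    (t : H -> H) (Omega : set H) (x y : H) : strongly_monotone_op t ->
  solves_vi (op_fun t) Omega x -> solves_vi (op_fun t) Omega y -> x = y.
Proof.
move=> [mu mu0 tmu] /solves_qvi_fun[Ox tx] /solves_qvi_fun[Oy ty].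
have := tmu x y; have := ty _ Ox; have := tx _ Oy.
rewrite -(opprB x y) linearN linearBl /= => le1 le2 le3.
have : mu * `|x - y| ^+ 2 <= 0 by lra.
by rewrite pmulr_rle0// exprn_even_le0//= normr_eq0 subr_eq0 => /eqP.
Qed.

Theorem proposition13 (R : realType) (H : hilbertType R)
    (f : H -> H) (D : {linear H -> H}) (Omega : set H) :
  lipschitz f ->
  monotone_op D -> bounded_near D (nbhs (0 : H)) ->
  Omega !=set0 -> closed Omega -> convex_set Omega ->
  strongly_monotone_op f ->
  let K : H -> set H := fun x => [set w - D (f x) | w in Omega] in
  let S : H -> set H := op_add (op_inv (op_fun f)) (op_fun D) in
  let T : H -> set H := op_inv S in
  (exists2 t : H -> H, T = op_fun t & strongly_monotone_op t) /\
  forall xs : H,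
    let ys : H := xs + D (f xs) in
    S (f xs) = [set ys] /\
    (solves_qvi (op_fun f) K xs <->
     unique (solves_vi T Omega) ys).
Proof.
move=> fL DM /linear_boundedP Db _ _ _ fM K S T.
have [g [fK gK gL gM]] := strongly_monotone_inverse fL fM.
have DL : lipschitz D.
  near (+oo : set_system R) => M.
  apply: (@klipschitzT_lipschitz _ _ _ M) => x y; rewrite -linearB.
  by move: (x - y); near: M.
have [t [SK tK _ tM]] := strongly_monotone_inverse
  (lipschitz_add gL DL) (strongly_monotone_addr gM DM).
have SE u : S u = [set g u + D u].
  apply/seteqP; split=> [y [a -> [_ -> ->]]|_ ->].
    by rewrite /= fK.
  by exists (g u); [exact/esym/gK | exists (D u)].
have TE : T = op_fun t.
  apply/funext => y; apply/seteqP; split => u; rewrite /T /op_inv /= SE /=.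
    by move=> ->; rewrite /op_fun/= SK.
  by move=> ->; rewrite tK.
split; first by exists t.
move=> xs ys; have tys : t ys = f xs by rewrite -(SK (f xs)) fK.
split; first by rewrite SE fK.
rewrite TE.
(* Uniqueness is automatic by strong monotonicity of [t], so only solvability has to be compared. *)
suff -> : solves_qvi (op_fun f) K xs <-> solves_vi (op_fun t) Omega ys.
  split=> [sol|[]//]; split=> // y; exact: strongly_monotone_vi_unique.
(* Both inequalities now involve the same vector [f xs], and the translation preserves the
   differences paired with it. *)
rewrite /solves_vi !solves_qvi_fun tys; split.
  move=> [[w Ow wE] fxs]; split; first by rewrite /ys -[X in X + _]wE subrK.
  move=> y Oy; rewrite /ys opprD addrA addrAC; apply: fxs; by exists y.
move=> [Oys fys]; split; first by exists ys; rewrite // /ys addrK.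
by move=> _ [w Ow <-]; rewrite -addrA -opprD [_ + xs]addrC; exact: fys.
Unshelve. all: by end_near. Qed.
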